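(* Let $\{N^f_\mu(t)\}_{t\ge 0}$, $N^f_\mu(t)=N(D^f(G_\mu(t)))$, be the geometric subordinated Poisson process with Bernstein function $f$, Poisson intensity $\lambda>0$ and geometric parameter $\mu>0$. Then for every $t\ge 0$ and every integer $k\ge 0$, $$\mathbb{P}[N^f_\mu(t)=k]=\frac{(-1)^k}{k!}\,\frac{d^k}{du^k}\left(\frac{1}{1+\mu t\,(1-e^{-f(\lambda u)})}\right)\Bigg|_{u=1}.$$
   Context: $\{D^f(t)\}_{t\ge0}$ is a Lévy subordinator (non-decreasing Lévy process) with Laplace transform $\mathbb{E}[e^{-sD^f(t)}]=e^{-tf(s)}$, where $f(s)=bs+\int_0^\infty(1-e^{-sx})\,\nu(dx)$, $b\ge0$, is a Bernstein function, and $\nu$ is a Lévy measure on the positive half-line with $\int_0^\infty (x\wedge 1)\,\nu(dx)<\infty$ and infinite total mass. $\{N(t)\}_{t\ge0}$ is a homogeneous Poisson process with intensity $\lambda>0$, independent of $D^f$. The subordinated Poisson process is $N^f(t)=N(D^f(t))$. The geometric counting process $\{G_\mu(t)\}_{t\ge0}$ with parameter $\mu>0$ is the mixed Poisson process whose random rate is exponentially distributed with mean $\mu$; it satisfies $G_\mu(0)=0$, has stationary increments, and $\mathbb{P}[G_\mu(t)=k]=\frac{1}{1+\mu t}\left(\frac{\mu t}{1+\mu t}\right)^k$ for $k=0,1,2,\dots$. The geometric subordinated Poisson process is $N^f_\mu(t):=N^f(G_\mu(t))$, $t\ge 0$, where $G_\mu$ is independent of $N^f$. *)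

(* Defs.v *)
From HB Require Import structures.
From mathcomp Require Import all_boot all_order all_algebra.
From mathcomp Require Import all_classical all_reals all_analysis.

Set Implicit Arguments.
Unset Strict Implicit.
Unset Printing Implicit Defensive.

Import Order.TTheory GRing.Theory Num.Theory.
Import numFieldNormedType.Exports.

Local Open Scope classical_set_scope.
Local Open Scope ring_scope.

(* Stochastic processes are functions R -> T -> U (time, then outcome). Only   *)
(* the times t >= 0 matter: no definition below looks at negative times.       *)
(* Path properties are required of every path, not just of almost every one;   *)
(* this is what makes a process composed with a random time measurable.        *)

Section Processes.
Context (d : measure_display) (T : measurableType d) (R : realType)
        (P : probability T R).

Definition process_sigma (d' : measure_display) (U : measurableType d')
    (X : R -> T -> U) : set (set T) :=
  <<s \bigcup_(t in [set t : R | 0 <= t])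
        preimage_set_system setT (X t) measurable >>.

Definition independent_processes (d1 d2 : measure_display)
    (U1 : measurableType d1) (U2 : measurableType d2)
    (X : R -> T -> U1) (Y : R -> T -> U2) : Prop :=
  forall A B : set T, process_sigma X A -> process_sigma Y B ->
    P (A `&` B) = (P A * P B)%E.

(* Some of the B i may be the whole line, so the product rule for the full     *)
(* family contains the one for every subfamily.                                *)
Definition mutually_independent (n : nat) (Y : nat -> T -> R) : Prop :=
  forall B : nat -> set R, (forall i, measurable (B i)) ->
    P (\bigcap_(i < n) (Y i @^-1` B i)) =
    (\prod_(i < n) P (Y i @^-1` B i))%E.

Definition increasing_times (n : nat) (s : nat -> R) : Prop :=
  0 <= s 0%N /\ forall i, (i < n)%N -> s i < s i.+1.

Definition independent_increments (X : R -> T -> R) : Prop :=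
  forall (n : nat) (s : nat -> R), increasing_times n s ->
    mutually_independent n (fun i w => X (s i.+1) w - X (s i) w).

Definition stationary_increments (X : R -> T -> R) : Prop :=
  forall (s h : R) (B : set R), 0 <= s -> 0 <= h -> measurable B ->
    P ((fun w => X (s + h) w - X s w) @^-1` B) =
    P ((fun w => X h w - X 0 w) @^-1` B).

Definition cadlag_paths (X : R -> T -> R) : Prop :=
  forall w : T,
    (forall t : R, 0 <= t -> X s w @[s --> t^'+] --> X t w) /\
    (forall t : R, 0 < t -> cvg (X s w @[s --> t^'-])).

Record levy_process (X : R -> {RV P >-> R}) : Prop := LevyProcess {
  levy_process0 : forall w, X 0 w = 0;
  levy_process_cadlag : cadlag_paths X;
  levy_process_indep : independent_increments X;
  levy_process_stationary : stationary_increments X }.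

Definition levy_subordinator (D : R -> {RV P >-> R}) : Prop :=
  levy_process D /\
  forall (w : T) (s t : R), 0 <= s -> s <= t -> D s w <= D t w.

Definition has_laplace_exponent (D : R -> {RV P >-> R}) (f : R -> R) : Prop :=
  forall s t : R, 0 <= s -> 0 <= t ->
    ('E_P[fun w => expR (- s * D t w)] = (expR (- t * f s))%:E)%E.

Record counting_process (N : R -> {RV P >-> nat}) : Prop := CountingProcess {
  counting_process0 : forall w, N 0 w = 0%N;
  counting_process_ndecr : forall (w : T) (s t : R),
    0 <= s -> s <= t -> (N s w <= N t w)%N;
  counting_process_cadlag : cadlag_paths (fun t w => (N t w)%:R) }.

(* Since paths are non-decreasing, the truncated subtraction on nat computes   *)
(* the increments exactly. The library's [poisson_pmf r] is the Poisson mass   *)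
(* function only for r > 0, whence the strictly increasing times.              *)
Record poisson_process (lambda : R) (N : R -> {RV P >-> nat}) : Prop :=
  PoissonProcess {
  poisson_process_counting : counting_process N;
  poisson_process_indep : independent_increments (fun t w => (N t w)%:R);
  poisson_process_law : forall (s t : R) (k : nat), 0 <= s -> s < t ->
    P [set w | (N t w - N s w)%N = k] =
    (poisson_pmf (lambda * (t - s)) k)%:E }.

(* Conditionally on the random rate Lambda, G is a Poisson process of rate     *)
(* Lambda; conditioning on sigma(Lambda) is expressed by integrating over the  *)
(* events {Lambda \in B}.                                                      *)
Record mixed_poisson_process (Lambda : {RV P >-> R})
    (G : R -> {RV P >-> nat}) : Prop := MixedPoissonProcess {
  mixed_poisson_counting : counting_process G;
  mixed_poisson_law : forall (n : nat) (s : nat -> R) (k : nat -> nat)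
      (B : set R), increasing_times n s -> measurable B ->
    P (Lambda @^-1` B `&`
       \bigcap_(i < n) [set w | (G (s i.+1) w - G (s i) w)%N = k i]) =
    (\int[P]_(w in Lambda @^-1` B)
       (\prod_(i < n) poisson_pmf (Lambda w * (s i.+1 - s i)) (k i))%:E)%E }.

(* [exponential_prob r] has rate r, i.e. mean r^-1. *)
Definition geometric_counting_process (mu : R)
    (G : R -> {RV P >-> nat}) : Prop :=
  exists Lambda : {RV P >-> R},
    (forall B : set R, measurable B ->
       distribution P Lambda B = exponential_prob mu^-1 B) /\
    mixed_poisson_process Lambda G.

Definition subordinated_poisson (N : R -> {RV P >-> nat})
    (D : R -> {RV P >-> R}) : R -> T -> nat :=
  fun t w => N (D t w) w.

Definition geometric_subordinated_poisson (N : R -> {RV P >-> nat})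
    (D : R -> {RV P >-> R}) (G : R -> {RV P >-> nat}) : R -> T -> nat :=
  fun t w => subordinated_poisson N D (G t w)%:R w.

End Processes.

Section Bernstein.
Context (R : realType).

Definition subordinator_levy_measure
    (nu : {measure set R -> \bar R}) : Prop :=
  nu `]-oo, 0%R]%classic = 0%E /\
  (\int[nu]_(x in `]0%R, +oo[) (Num.min x 1)%:E < +oo)%E.

Definition bernstein_fun (b : R) (nu : {measure set R -> \bar R}) (s : R) : R :=
  b * s + \int[nu]_(x in `]0, +oo[) (1 - expR (- s * x)).

End Bernstein.

(* Main.v *)
(* Conditioning on G t = n, which is independent of N (D n), and then on the
   value of D n, the probability that N (D (G t)) = k is the integral of the
   Poisson mass x^k e^{-x} / k! against the measure
   m = sum_n P[G t = n] law(lambda D n).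
   The same integral is (-1)^k / k! times the k-th derivative at u = 1 of the
   Laplace transform of m, by differentiation under the integral sign. That
   transform is sum_n P[G t = n] z^n with z = E[e^{-u lambda D 1}] =
   e^{-f(lambda u)}; averaging the Poisson generating function e^{-L t (1 - z)}
   over the exponential rate L evaluates it to 1 / (1 + mu t (1 - z)). *)

Require Import Defs.
From HB Require Import structures.
From mathcomp Require Import all_boot all_order all_algebra.
From mathcomp Require Import all_classical all_reals all_analysis.
From mathcomp Require Import measurable_realfun.
From mathcomp Require Import ring lra.

Import Order.TTheory GRing.Theory Num.Theory.
Import numFieldNormedType.Exports.

Local Open Scope classical_set_scope.
Local Open Scope ring_scope.

(** * Iterated derivatives of a Laplace transform *)

Lemma eq_near_derive1n (R : numFieldType) (V : normedModType R) (k : nat)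
    (f g : R -> V) (a : R) :
  (\forall x \near a, f x = g x) -> derive1n k f a = derive1n k g a.
Proof.
elim: k a => [|k IH] a fg; first by rewrite !derive1n0; exact: nbhs_singleton fg.
rewrite !derive1nS !derive1E; apply: near_eq_derive.
by move/near_join : fg; apply: filterS => x; exact: IH.
Qed.

(** For [x >= 0] a single term of the exponential series is at most the whole sum. This bounds both
    the Laplace integrands and the Poisson mass. *)
Lemma exprn_le_expR (R : realType) (n : nat) (x : R) :
  0 <= x -> x ^+ n <= n`!%:R * expR x.
Proof.
move=> x0; rewrite -ler_pdivrMl ?ltr0n ?fact_gt0// mulrC.
case: n => [|n]; first by rewrite expr0 fact0 divr1 -expR0 ler_expR.
by apply: le_trans (expR_ge1Dxn n x0); rewrite lerDr.
Qed.

Section Laplace.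
Context {R : realType} (m : {measure set R -> \bar R}).
Hypothesis m_fin : (m `[0%R, +oo[%classic < +oo)%E.

Let deriv_integrand (j : nat) (x u : R) :
  is_derive u 1 (fun v => (- x) ^+ j * expR (- v * x))
    ((- x) ^+ j.+1 * expR (- u * x)).
Proof.
apply: is_derive_eq.
by rewrite /GRing.scale/= exprSr; ring.
Qed.

(** The measure of the half-line is finite, so a bound on the integrand suffices: with y = u x, the
    inequality y^j <= j! e^y gives x^j e^{-u x} <= j! / u^j. *)
Lemma laplace_integrable (j : nat) (u : R) : 0 < u ->
  m.-integrable `[0%R, +oo[ (EFin \o (fun x => (- x) ^+ j * expR (- u * x))).
Proof.
move=> u0; apply: measurable_bounded_integrable => //.
  apply: measurable_funTS; apply: measurable_funM.
    apply: measurable_funX; exact: measurable_funN.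
  apply: measurableT_comp => //; exact: measurable_funM.
exists (j`!%:R / u ^+ j); split; first exact: num_real.
move=> M /ltW; move=> + x /=; rewrite in_itv/= andbT => + x0; apply: le_trans.
rewrite normrM normrX normrN (ger0_norm x0) (ger0_norm (expR_ge0 _)).
rewrite mulNr expRN ler_pdivrMr ?expR_gt0// mulrAC ler_pdivlMr ?exprn_gt0//.
by rewrite -exprMn mulrC exprn_le_expR// mulr_ge0// ltW.
Qed.

Lemma derive1n_laplace (j : nat) (u : R) : 0 < u ->
  derive1n j (fun v => \int[m]_(x in `[0, +oo[) expR (- v * x)) u =
  \int[m]_(x in `[0, +oo[) ((- x) ^+ j * expR (- u * x)).
Proof.
elim: j u => [|j IH] u u0.
  by rewrite derive1n0; apply: eq_Rintegral => x _; rewrite expr0 mul1r.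
rewrite derive1nS derive1E.
(* The induction hypothesis holds at positive points only; this is enough, since the derivative at
   [u] depends only on a neighbourhood of [u]. *)
rewrite (_ : 'D_1 _ u = 
    'D_1 (fun v : R => \int[m]_(x in `[0, +oo[) ((- x) ^+ j * expR (- v * x))) u);
  last first.
  apply: near_eq_derive; near=> v; apply: IH; near: v; exact: lt_nbhsr.
(* Staying to the right of [u / 2] makes the derivative of the integrand at [u / 2] a dominating
   function: e^{-v x} <= e^{-(u/2) x} for v > u/2 and x >= 0. *)
have Iu : `]u / 2, u + 1[%classic u.
  by rewrite /= in_itv/= ltrDl ltr01 andbT; lra.
have I0 v : `]u / 2, u + 1[%classic v -> 0 < v.
  by rewrite /= in_itv/= => /andP[+ _]; apply: lt_trans; lra.
rewrite -derive1E (@differentiation_under_integral _ _ _ m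
  (fun v x => (- x) ^+ j * expR (- v * x)) _ _ _ _ _ Iu _ _
  (fun x => `|(- x) ^+ j.+1 * expR (- (u / 2) * x)|)) //.
- apply: eq_Rintegral => x _; rewrite partial1of2E; exact: derive_val.
- move=> v /I0; exact: laplace_integrable.
- have u20 : 0 < u / 2 by lra.
  exact: integrable_norm (laplace_integrable j.+1 _ u20).
- move=> v x /[dup]/I0 v0; rewrite /= !in_itv/= andbT => /andP[uv _] x0.
  rewrite partial1of2E (@derive_val _ _ _ _ _ _ _ (deriv_integrand _ _ _)).
  rewrite !normrM ler_wpM2l// !ger0_norm ?expR_ge0// ler_expR.
  by rewrite !mulNr lerN2 ler_wpM2r// ltW.
Unshelve. all: end_near. Qed.

End Laplace.

(** * Measures with a density, and the exponential law *)

Section Density.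
Local Open Scope ereal_scope.
Import HBNNSimple.

(** Monotone convergence on both sides reduces to simple functions, and linearity to indicators,
    where the equality is the hypothesis on [nu]. *)
Lemma ge0_integral_density (d : measure_display) (T : measurableType d)
    (R : realType) (mu nu : {measure set T -> \bar R}) (g : T -> R)
    (f : T -> \bar R) :
  measurable_fun [set: T] g -> (forall x, (0 <= g x)%R) ->
  (forall A, measurable A -> nu A = \int[mu]_(x in A) (g x)%:E) ->
  measurable_fun [set: T] f -> (forall x, 0 <= f x) ->
  \int[nu]_x f x = \int[mu]_x (f x * (g x)%:E).
Proof.
move=> mg g0 nuE mf f0.
have mgE : measurable_fun [set: T] (EFin \o g) by exact/measurable_EFinP.
pose f_ := nnsfun_approx measurableT mf.
have fE x : limn (fun n => (f_ n x)%:E) = f x.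
  by apply/cvg_lim => //; exact: cvg_nnsfun_approx.
have f_nd x : nondecreasing_seq (fun n => (f_ n x)%:E).
  by move=> m n mn; rewrite lee_fin; exact/lefP/nd_nnsfun_approx.
transitivity (limn (fun n => \int[nu]_x (f_ n x)%:E)).
  rewrite -monotone_convergence//=.
  - by apply: eq_integral => x _; rewrite fE.
  - by move=> n; exact/measurable_EFinP.
  - by move=> n x _; rewrite lee_fin.
transitivity (limn (fun n => \int[mu]_x ((f_ n x)%:E * (g x)%:E))); last first.
  rewrite -monotone_convergence//=.
  - apply: eq_integral => x _; rewrite -(fE x) -limeMr//.
    exact: ereal_nondecreasing_is_cvgn.
  - by move=> n; apply: emeasurable_funM => //; exact/measurable_EFinP.
  - by move=> n x _; rewrite mule_ge0 ?lee_fin.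
  - by move=> x _ m n mn; rewrite lee_wpmul2r ?lee_fin ?g0//; exact: f_nd.
apply: congr_lim; apply/funext => n.
rewrite integralT_nnsfun sintegralE.
under [RHS]eq_integral => x _.
  rewrite fimfunE -fsumEFin// ge0_mule_fsuml; last first.
    by move=> r; rewrite EFinM nnfun_muleindic_ge0.
  over.
rewrite ge0_integral_fsum//; last 2 first.
  - move=> r; apply: emeasurable_funM => //.
    by apply/measurable_EFinP; exact: measurable_funM.
  - by move=> r x _; rewrite mule_ge0 ?lee_fin// -lee_fin EFinM nnfun_muleindic_ge0.
apply: eq_fsbigr => r /set_mem[x _ fxr].
have r0 : (0 <= r)%R by rewrite -fxr.
rewrite nuE//; under [RHS]eq_integral do rewrite EFinM -muleA.
rewrite ge0_integralZl//.
- congr (_ * _); rewrite integral_mkcond; apply: eq_integral => y _.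
  by rewrite patchE indicE; case: ifPn => _; rewrite ?mul1e ?mul0e.
- by apply: emeasurable_funM => //; exact/measurable_EFinP.
- by move=> y _; rewrite mule_ge0 ?lee_fin.
Qed.
End Density.

Section Exponential.
Context {d : measure_display} {T : measurableType d} {R : realType}
  (P : probability T R) (r : R) (L : {RV P >-> R}).
Hypothesis r_gt0 : 0 < r.
Hypothesis L_exp : forall B : set R, measurable B ->
  distribution P L B = exponential_prob r B.

(** On the half-line, e^{-c x} times the density of rate r is r / (r + c) times the density of rate
    r + c, whose integral is 1. *)
Lemma exponential_laplace (c : R) : 0 <= c ->
  (\int[P]_w (expR (- (c * L w)))%:E = (r / (r + c))%:E)%E.
Proof.
move=> c0.
have rc0 : 0 < r + c by rewrite ltr_pwDl.
(* [lebesgue_measure] lives on [measurableTypeR R] and [distribution P L] on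
   [R]: same sigma-algebra, different displays. [L'] is [L] moved to the former. *)
have mL : measurable_fun [set: T] (L : T -> measurableTypeR R).
  by move=> _ B mB; exact: (@measurable_funPT _ _ _ _ L).
pose L' : {mfun T >-> measurableTypeR R} :=
  HB.pack (L : T -> measurableTypeR R) (isMeasurableFun.Build _ _ _ _ _ mL).
have mexp : measurable_fun [set: measurableTypeR R]
    (fun x : measurableTypeR R => (expR (- (c * x)))%:E).
  apply/measurable_EFinP; apply: measurableT_comp => //.
  by apply: measurable_funN; exact: measurable_funM.
transitivity (\int[distribution P L']_x (expR (- (c * x)))%:E)%E.
  by rewrite ge0_integral_distribution// => x; rewrite lee_fin expR_ge0.
transitivity (\int[lebesgue_measure]_x
    ((expR (- (c * x)))%:E * (exponential_pdf r x)%:E))%E; last first.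
- transitivity (\int[lebesgue_measure]_x
      ((r / (r + c))%:E * (exponential_pdf (r + c) x)%:E))%E.
    apply: eq_integral => x _; rewrite -!EFinM; congr EFin.
    have [x0|x0] := leP 0 x; last first.
      by rewrite !lt0_exponential_pdf// !mulr0.
    rewrite !exponential_pdfE// [RHS]mulrA divfK ?gt_eqF// mulrCA -expRD.
    by congr (_ * expR _); ring.
  rewrite ge0_integralZl//.
  + by rewrite integral_exponential_pdf// mule1.
  + by apply/measurable_EFinP; exact: measurable_exponential_pdf.
  + by move=> x _; rewrite lee_fin exponential_pdf_ge0// ltW.
  + by rewrite lee_fin divr_ge0// ltW.
apply: (@ge0_integral_density _ _ _ _ (distribution P L') (exponential_pdf r)
  (fun x => (expR (- (c * x)))%:E)) => //.
- exact: measurable_exponential_pdf.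
- by move=> x; exact: exponential_pdf_ge0 (ltW r_gt0) _.
Qed.

(** The density vanishes at negative points but not at 0, so the endpoint is first removed as a
    Lebesgue-null set. *)
Lemma exponential_le0 : P (L @^-1` `]-oo, 0%R]) = 0%E.
Proof.
rewrite -[LHS]/(distribution P L `]-oo, 0%R]%classic) L_exp//.
rewrite /exponential_prob -integral_itv_bndo_bndc//; last first.
  by apply/measurable_EFinP/measurable_funTS; exact: measurable_exponential_pdf.
apply: integral0_eq => x; rewrite /= in_itv/= => x0.
by rewrite lt0_exponential_pdf.
Qed.

End Exponential.

(** * Generating functions of the Poisson and geometric laws *)

Lemma poisson_pmf_pgf (R : realType) (x z : R) : 0 < x -> 0 <= z ->
  (\sum_(0 <= n <oo) (poisson_pmf x n * z ^+ n)%:E = (expR (- (x * (1 - z))))%:E)%E.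
Proof.
move=> x0 z0.
transitivity ((expR (- x))%:E * \sum_(0 <= n <oo) (exp_coeff (x * z) n)%:E)%E.
  rewrite -nneseriesZl; last first.
    by move=> n _; rewrite lee_fin exp_coeff_ge0// mulr_ge0// ltW.
  apply: eq_eseriesr => n _; rewrite -EFinM /poisson_pmf x0 exp_coeffE exprMn.
  by congr EFin; ring.
have -> : (\sum_(0 <= n <oo) (exp_coeff (x * z) n)%:E = (expR (x * z))%:E)%E.
  rewrite /expR -EFin_lim; last exact: is_cvg_series_exp_coeff.
  by apply/congr_lim/funext => n; rewrite /= /series/= sumEFin.
by rewrite -EFinM -expRD; congr ((expR _)%:E); ring.
Qed.

Lemma geometric_counting_pgf (d : measure_display) (T : measurableType d)
    (R : realType) (P : probability T R) (mu : R) (G : R -> {RV P >-> nat})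
    (t z : R) :
  0 < mu -> geometric_counting_process mu G -> 0 <= t -> 0 <= z <= 1 ->
  (\sum_(0 <= n <oo) P [set w | G t w = n] * (z ^+ n)%:E =
   (1 / (1 + mu * t * (1 - z)))%:E)%E.
Proof.
move=> mu0 [L [Lexp [[G0 _ _] Glaw]]]; rewrite le_eqVlt.
(* Time 0 is treated apart because [mixed_poisson_law] asks for strictly increasing times; there [G]
   vanishes and only the term n = 0 survives. *)
move=> /predU1P[<-|t0] /andP[z0 z1].
  rewrite nneseries_recl//; last first.
    by move=> n _; rewrite mule_ge0// lee_fin exprn_ge0.
  rewrite eseries0 => [|n n0 _]; last first.
    rewrite (_ : [set w | _] = set0) ?measure0 ?mul0e//.
    by apply/seteqP; split => // w /=; rewrite G0 => n0'; rewrite -n0' in n0.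
  rewrite (_ : [set w | _] = setT); last first.
    by apply/seteqP; split => // w _ /=; rewrite G0.
  by rewrite probability_setT adde0 expr0 mul1e mulr0 mul0r addr0 divr1.
have imu0 : 0 < mu^-1 by rewrite invr_gt0.
(* [poisson_pmf] takes a default value at nonpositive rates, so everything is computed on [D], where
   the rate is positive; its complement [N] is null. *)
pose N := L @^-1` `]-oo, 0%R].
pose D := L @^-1` `]0%R, +oo[.
have mN : measurable N by exact: measurable_funPTI.
have mD : measurable D by exact: measurable_funPTI.
have DN : D = [set: T] `\` N.
  by rewrite setTD preimage_setC setCitvl.
have N0 : P N = 0%E by exact: exponential_le0 Lexp.
have mG n : measurable [set w | G t w = n].
  rewrite (_ : [set w | _] = G t @^-1` [set n])//; exact: measurable_funPTI.
have GE n : P [set w | G t w = n] =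
    (\int[P]_(w in D) (poisson_pmf (L w * t) n)%:E)%E.
  rewrite (measureDI P (mG n) mN).
  rewrite [X in (_ + X)%E](_ : _ = 0%E) ?adde0; last first.
    apply/eqP; rewrite -measure_le0 -N0 le_measure ?inE//.
      exact: measurableI.
  (* A single increment, from time 0 to time [t]. *)
  have := Glaw 1%N (fun i => i%:R * t) (fun=> n) `]0%R, +oo[%classic.
  rewrite -/D bigcap_mkord big_ord_recl big_ord0 setIT mul0r mul1r.
  under eq_integral do rewrite big_ord_recl big_ord0 mulr1 mul0r mul1r subr0.
  move=> <-//; last first.
    split; rewrite ?mul0r// => i; rewrite ltnS leqn0 => /eqP ->.
    by rewrite mul0r mul1r.
  congr (P _); apply/seteqP; split => w /=; rewrite DN/= G0 subn0.
    by move=> [].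
  by move=> [[]].
transitivity (\int[P]_(w in D) \sum_(0 <= n <oo)
    (poisson_pmf (L w * t) n * z ^+ n)%:E)%E.
  have mpmf n : measurable_fun D (fun w => (poisson_pmf (L w * t) n)%:E).
    apply/measurable_EFinP; apply: measurable_funTS.
    apply: (measurableT_comp (measurable_poisson_pmf n measurableT)).
    exact: measurable_funM.
  rewrite integral_nneseries//; last 2 first.
  - by move=> n; under eq_fun do rewrite EFinM; exact: emeasurable_funM.
  - by move=> n w _; rewrite lee_fin mulr_ge0 ?poisson_pmf_ge0 ?exprn_ge0.
  apply: eq_eseriesr => n _.
  under eq_integral do rewrite EFinM muleC.
  rewrite GE muleC ge0_integralZl//.
  - by move=> w _; rewrite lee_fin poisson_pmf_ge0.
  - by rewrite lee_fin exprn_ge0.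
transitivity (\int[P]_(w in D) (expR (- ((t * (1 - z)) * L w)))%:E)%E.
  apply: eq_integral => w; rewrite inE /D/= in_itv/= andbT => Lw0.
  by rewrite poisson_pmf_pgf ?mulr_gt0//; congr ((expR _)%:E); ring.
have c0 : 0 <= t * (1 - z) by rewrite mulr_ge0 ?subr_ge0// ltW.
(* Adding the null set [N] back turns the integral over [D] into the full Laplace transform of the
   rate at t (1 - z). *)
rewrite DN -ge0_negligible_integral//; last first.
  apply/measurable_EFinP; apply: measurableT_comp => //.
  by apply: measurable_funN; exact: measurable_funM.
rewrite (exponential_laplace _ _ _ imu0 Lexp)//; congr EFin.
have mc0 : mu^-1 + t * (1 - z) != 0 by rewrite gt_eqF// ltr_pwDl.
have mc1 : 1 + mu * t * (1 - z) != 0.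
  by rewrite gt_eqF// ltr_pwDl// -mulrA mulr_ge0// ltW.
by field; rewrite mc1 gt_eqF.
Qed.

(** * A Poisson process at an independent random time *)

Section PoissonMass.
Context {R : realType}.
Implicit Types (k : nat) (x : R).

(* Unlike [poisson_pmf], which is 1 for nonpositive rates, this is right at
   rate 0 and continuous there. *)
Definition poisson_mass k x : R := x ^+ k / k`!%:R * expR (- x).

Lemma poisson_massE k x : 0 < x -> poisson_pmf x k = poisson_mass k x.
Proof. by move=> x0; rewrite /poisson_pmf x0. Qed.

Lemma poisson_mass_ge0 k x : 0 <= x -> 0 <= poisson_mass k x.
Proof.
by move=> x0; rewrite mulr_ge0 ?expR_ge0// divr_ge0// exprn_ge0.
Qed.

Lemma poisson_mass_le1 k x : 0 <= x -> poisson_mass k x <= 1.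
Proof.
move=> x0; rewrite /poisson_mass expRN ler_pdivrMr ?expR_gt0// mul1r.
by rewrite ler_pdivrMr ?ltr0n ?fact_gt0// mulrC exprn_le_expR.
Qed.

Lemma continuous_poisson_mass k : continuous (poisson_mass k).
Proof.
move=> x; apply: cvgM.
  apply: cvgM; last exact: cvg_cst.
  exact: exprn_continuous.
apply: (cvg_comp _ _ (cvgN cvg_id)); exact: continuous_expR.
Qed.

End PoissonMass.

Section UpperGrid.
Context {R : realType}.
Implicit Types (m : nat) (x : R).

(* Approximation from strictly above: N is only right-continuous, and its law
   is known at positive times only. *)
Definition upper_grid m x : R :=
  (Num.truncn (x * m.+1%:R)).+1%:R / m.+1%:R.

Lemma upper_grid_gt m x : x < upper_grid m x.
Proof. by rewrite ltr_pdivlMr// truncnS_gt. Qed.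

Lemma upper_grid_cvg x : 0 <= x -> upper_grid m x @[m --> \oo] --> x.
Proof.
move=> x0; apply: (@squeeze_cvgr _ _ _ _ (cst x) (fun m => x + m.+1%:R^-1)).
- apply: nearW => m; rewrite ltW ?upper_grid_gt//=.
  rewrite ler_pdivrMr// mulrDl mulVf// -natr1 lerD2r.
  by rewrite truncn_le mulr_ge0.
- exact: cvg_cst.
- rewrite -[X in _ --> X]addr0; apply: cvgD; first exact: cvg_cst.
  exact: cvg_harmonic.
Qed.

Lemma measurable_truncn_scale m :
  measurable_fun [set: R] (fun x => (Num.truncn (x * m.+1%:R))%:R : R).
Proof.
apply: nondecreasing_measurable => // x y xy.
by rewrite ler_nat le_truncn// ler_wpM2r.
Qed.

Lemma measurable_upper_grid m : measurable_fun [set: R] (upper_grid m).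
Proof.
rewrite /upper_grid; under eq_fun do rewrite -natr1.
apply: measurable_funM => //; apply: measurable_funD => //.
exact: measurable_truncn_scale.
Qed.

Lemma measurable_upper_grid_cell m (j : nat) :
  measurable [set x : R | Num.truncn (x * m.+1%:R) = j].
Proof.
have := measurable_truncn_scale m measurableT _ (measurable_set1 j%:R).
rewrite setTI; congr measurable; apply/seteqP; split => x /=.
  by move=> /eqP; rewrite eqr_nat => /eqP.
by move=> ->.
Qed.

End UpperGrid.

Section PoissonRandomTime.
Context {d : measure_display} {T : measurableType d} {R : realType}
  (P : probability T R) (lambda : R) (N : R -> {RV P >-> nat}) (X : {RV P >-> R}).
Hypothesis lambda_gt0 : 0 < lambda.
Hypothesis poissonN : poisson_process lambda N.
Hypothesis X_ge0 : forall w, 0 <= X w.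
Hypothesis indepNX : forall (s : R) (k : nat) (B : set R),
  0 <= s -> measurable B ->
  P ([set w | N s w = k] `&` X @^-1` B) =
  (P [set w | N s w = k] * P (X @^-1` B))%E.

Let mN (s : R) (k : nat) : measurable [set w | N s w = k].
Proof.
rewrite (_ : [set w | _] = N s @^-1` [set k])//; exact: measurable_funPTI.
Qed.

Let poisson_law (s : R) (k : nat) : 0 < s ->
  P [set w | N s w = k] = (poisson_mass k (lambda * s))%:E.
Proof.
move=> s0; rewrite -poisson_massE ?mulr_gt0// -[in RHS](subr0 s).
rewrite -(poisson_process_law poissonN) //.
congr (P _); apply/seteqP; split => w /=;
  by rewrite (counting_process0 (poisson_process_counting poissonN)) subn0.
Qed.

Let cell m (j : nat) := [set w | Num.truncn (X w * m.+1%:R) = j].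

Let mcell m j : measurable (cell m j).
Proof.
rewrite (_ : cell m j = X @^-1` [set x | Num.truncn (x * m.+1%:R) = j])//.
by apply: measurable_funPTI => //; exact: measurable_upper_grid_cell.
Qed.

Let cell_trivIset m : trivIset [set: nat] (cell m).
Proof.
apply/trivIsetP => i j _ _ /eqP ij; apply/seteqP; split => // w [/= wi wj].
by apply: ij; rewrite -wi -wj.
Qed.

Let cell_cover m : \bigcup_j cell m j = [set: T].
Proof.
by apply/seteqP; split => // w _; exists (Num.truncn (X w * m.+1%:R)).
Qed.

Let grid_set m k := [set w | N (upper_grid m (X w)) w = k].

(** On [cell m j] the grid time is the constant (j + 1) / (m + 1), so the event at a random time
    splits into countably many events at fixed times. *)
Let grid_set_cell m k : grid_set m k =
  \bigcup_j ([set w | N (j.+1%:R / m.+1%:R) w = k] `&` cell m j).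
Proof.
apply/seteqP; split => [w wk|w [j _ [/= wk wj]]].
  by exists (Num.truncn (X w * m.+1%:R)).
by rewrite /grid_set/= /upper_grid wj.
Qed.

Let mgrid_set m k : measurable (grid_set m k).
Proof.
by rewrite grid_set_cell; apply: bigcup_measurable => j _; exact: measurableI.
Qed.

Let measurable_mass (Y : T -> R) k : measurable_fun [set: T] Y ->
  measurable_fun [set: T] (fun w => (poisson_mass k (lambda * Y w))%:E).
Proof.
move=> mY; apply/measurable_EFinP.
apply: (measurableT_comp
  (continuous_measurable_fun (continuous_poisson_mass k))).
exact: measurable_funM.
Qed.

(** On each cell, independence at a fixed time factors the probability, and the Poisson mass at that
    time is the constant value of the integrand. *)
Let grid_law m k : P (grid_set m k) =
  (\int[P]_w (poisson_mass k (lambda * upper_grid m (X w)))%:E)%E.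
Proof.
have mass0 w : (0 <= (poisson_mass k (lambda * upper_grid m (X w)))%:E)%E.
  rewrite lee_fin poisson_mass_ge0// mulr_ge0// ltW//.
  by rewrite (le_lt_trans (X_ge0 w))// upper_grid_gt.
rewrite grid_set_cell measure_semi_bigcup//; last 3 first.
- by move=> j; exact: measurableI.
- apply/trivIsetP => i j _ _ ij; apply/seteqP; split => // w /= [[_ wi] [_ wj]].
  by move: ij; rewrite -wi -wj eqxx.
- by rewrite -grid_set_cell.
rewrite -(cell_cover m) ge0_integral_bigcup//; last first.
  rewrite cell_cover; apply: measurable_mass.
  exact: measurableT_comp (measurable_upper_grid m) _.
apply: eq_eseriesr => j _.
transitivity (P [set w | N (j.+1%:R / m.+1%:R) w = k] * P (cell m j))%E.
  apply: (indepNX _ _ [set x | Num.truncn (x * m.+1%:R) = j]) => //.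
  exact: measurable_upper_grid_cell.
rewrite poisson_law; last by rewrite divr_gt0.
rewrite -(integral_cst P (mcell m j)); apply: eq_integral => w.
by rewrite inE /cell/= /upper_grid => ->.
Qed.

(** The grid times decrease to [X w] strictly from the right in the sense of [cvg_at_rightP], so
    right-continuity gives convergence; a convergent sequence of integers is eventually constant. *)
Let N_upper_grid w : \forall m \near \oo, N (upper_grid m (X w)) w = N (X w) w.
Proof.
have [_ _ cad] := poisson_process_counting poissonN.
have [/(_ _ (X_ge0 w)) cadX _] := cad w.
have : (N (upper_grid m (X w)) w)%:R @[m --> \oo] --> ((N (X w) w)%:R : R).
  apply: ((cvg_at_rightP _ _ _).1 cadX (fun m => upper_grid m (X w))).
  by split; [move=> m; exact: upper_grid_gt|exact: upper_grid_cvg].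
(* Two integers at distance less than 1 coincide. *)
move/cvgrPdist_lt => /(_ 1 ltr01); apply: filterS => m.
have [NN|NN|//] := ltngtP (N (upper_grid m (X w)) w) (N (X w) w).
  rewrite ger0_norm ?subr_ge0 ?ler_nat 1?ltnW// ltrBlDl natr1 ltr_nat ltnS.
  by rewrite leqNgt NN.
rewrite ler0_norm ?subr_le0 ?ler_nat 1?ltnW// opprB ltrBlDl natr1 ltr_nat ltnS.
by rewrite leqNgt NN.
Qed.

Let indic_grid_cvg k w :
  \1_(grid_set m k) w @[m --> \oo] --> (\1_[set w | N (X w) w = k] w : R).
Proof.
apply: cvg_near_cst.
have := N_upper_grid w; apply: filterS => m Nw.
rewrite !indicE; congr (nat_of_bool _)%:R.
by apply/idP/idP; rewrite !inE /grid_set/= Nw.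
Qed.

(** The indicator of the event is the pointwise limit of the indicators of the measurable grid
    events. *)
Lemma measurable_random_time (k : nat) : measurable [set w | N (X w) w = k].
Proof.
apply/(measurable_indicP R); apply: measurable_fun_cvg; last first.
  by move=> w _; exact: indic_grid_cvg.
by move=> m; exact: measurable_indic.
Qed.

(** Both sides of [grid_law] pass to the limit by dominated convergence with bound 1. On the right
    this uses continuity of [poisson_mass] up to rate 0, since [X] may vanish. *)
Lemma poisson_random_time (k : nat) :
  P [set w | N (X w) w = k] = (\int[P]_w (poisson_mass k (lambda * X w))%:E)%E.
Proof.
have int1 : P.-integrable [set: T] (cst 1%E).
  exact: finite_measure_integrable_cst.
have cvg1 : P (grid_set m k) @[m --> \oo] --> P [set w | N (X w) w = k].
  have PE A : measurable A -> P A = (\int[P]_w (\1_A w)%:E)%E.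
    by move=> mA; rewrite integral_indic// setIT.
  rewrite PE; last exact: measurable_random_time.
  under eq_fun do rewrite PE//.
  apply: (@dominated_cvg _ _ _ _ _ measurableT _ _ (cst 1%E)) => //.
  - by move=> m; apply/measurable_EFinP; exact: measurable_indic.
  - move=> w _; apply: cvg_EFin; first exact: nearW.
    exact: indic_grid_cvg.
  - by move=> m w _; rewrite gee0_abs ?lee_fin// indicE; case: (_ \in _).
suff cvg2 : P (grid_set m k) @[m --> \oo] -->
    (\int[P]_w (poisson_mass k (lambda * X w))%:E)%E.
  exact: cvg_unique cvg1 cvg2.
under eq_fun do rewrite grid_law.
apply: (@dominated_cvg _ _ _ _ _ measurableT _ _ (cst 1%E)) => //.
- move=> m; apply: measurable_mass.
  exact: measurableT_comp (measurable_upper_grid m) _.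
- move=> w _; apply: cvg_EFin; first exact: nearW.
  apply: (cvg_comp (fun m => lambda * upper_grid m (X w)) (poisson_mass k)).
    by apply: cvgM; [exact: cvg_cst|exact: upper_grid_cvg].
  exact: continuous_poisson_mass.
- move=> m w _; have grid0 : 0 <= lambda * upper_grid m (X w).
    by rewrite mulr_ge0// ltW// (le_lt_trans (X_ge0 w))// upper_grid_gt.
  by rewrite gee0_abs ?lee_fin ?poisson_mass_le1 ?poisson_mass_ge0.
Qed.

End PoissonRandomTime.

(** * Countable mixtures of laws of nonnegative variables *)

Section Mixture.
Context {d : measure_display} {T : measurableType d} {R : realType}
  (P : probability T R) (a : nat -> {nonneg R}) (X : nat -> {RV P >-> R}).
Hypothesis X_ge0 : forall n w, 0 <= X n w.

Definition mixture : {measure set R -> \bar R} :=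
  mseries (fun n => mscale (a n) (distribution P (X n))) 0.

(** Each [X n] is nonnegative, so restricting to the half-line loses no mass. It also asks for
    nonnegativity of [f] only there: [poisson_mass k] is negative at negative points when [k] is
    odd. *)
Lemma integral_mixture (f : R -> \bar R) :
  measurable_fun [set: R] f -> (forall x : R, 0 <= x -> (0 <= f x)%E) ->
  (\int[mixture]_(x in `[0%R, +oo[) f x =
   \sum_(0 <= n <oo) (a n)%:num%:E * \int[P]_w f (X n w))%E.
Proof.
move=> mf f0.
have f0' (x : R) : `[0, +oo[%classic x -> (0 <= f x)%E.
  by rewrite /= in_itv/= andbT; exact: f0.
have mfS : measurable_fun (`[0, +oo[%classic : set R) f by exact: measurable_funTS.
rewrite ge0_integral_measure_series//; apply: eq_eseriesr => n _.
rewrite ge0_integral_mscale//; congr (_ * _)%E.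
rewrite ge0_integral_pushforward//; last by move=> x /set_mem; exact: f0'.
rewrite (_ : _ @^-1` _ = setT)//.
by apply/seteqP; split => // w _; rewrite /= in_itv/= X_ge0.
Qed.

End Mixture.

(** * The law of the geometric subordinated Poisson process *)

Lemma process_sigma_preimage (d d' : measure_display) (T : measurableType d)
    (U : measurableType d') (R : realType) (X : R -> T -> U) (t : R) (B : set U) :
  0 <= t -> measurable B -> process_sigma X (X t @^-1` B).
Proof.
move=> t0 mB; apply: sub_sigma_algebra; exists t => //=.
by exists B => //; rewrite setTI.
Qed.

Lemma bernstein_fun_ge0 (R : realType) (b : R) (nu : {measure set R -> \bar R})
    (s : R) : 0 <= b -> 0 <= s -> 0 <= bernstein_fun b nu s.
Proof.
move=> b0 s0; rewrite /bernstein_fun addr_ge0 ?mulr_ge0//.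
apply: Rintegral_ge0 => x; rewrite /= in_itv/= andbT => x0.
by rewrite subr_ge0 -expR0 ler_expR mulNr oppr_le0 mulr_ge0// ltW.
Qed.

Theorem proposition3p1 (R : realType) (d : measure_display)
  (T : measurableType d) (P : probability T R)
  (b : R) (nu : {measure set R -> \bar R}) (lambda mu : R)
  (D : R -> {RV P >-> R}) (N G : R -> {RV P >-> nat})
  (b_ge0 : 0 <= b)
  (levy_nu : subordinator_levy_measure nu)
  (nu_infinite : nu `]0%R, +oo[%classic = +oo%E)
  (lambda_gt0 : 0 < lambda) (mu_gt0 : 0 < mu)
  (subD : levy_subordinator D)
  (laplaceD : has_laplace_exponent D (bernstein_fun b nu))
  (poissonN : poisson_process lambda N)
  (indepND : independent_processes P N D)
  (geomG : geometric_counting_process mu G)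
  (indepGN : independent_processes P G (subordinated_poisson N D))
  (t : R) (t_ge0 : 0 <= t) (k : nat) :
  P [set w | geometric_subordinated_poisson N D G t w = k] =
  ((-1) ^+ k / k`!%:R *
   derive1n k
     (fun u : R =>
        1 / (1 + mu * t * (1 - expR (- bernstein_fun b nu (lambda * u)))))
     1)%:E.
Proof.
have D_ge0 s w : 0 <= s -> 0 <= D s w.
  have [levyD monoD] := subD.
  by move=> s0; rewrite -(levy_process0 levyD w) monoD.
pose NDset n := [set w | subordinated_poisson N D n%:R w = k].
pose Gset n := [set w | G t w = n].
have mG n : measurable (Gset n).
  by rewrite (_ : Gset n = G t @^-1` [set n])//; exact: measurable_funPTI.
have indepNDn n s j (B : set R) : 0 <= s -> measurable B ->
    P ([set w | N s w = j] `&` D n%:R @^-1` B) =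
    (P [set w | N s w = j] * P (D n%:R @^-1` B))%E.
  move=> s0 mB; apply: indepND; last exact: process_sigma_preimage.
  exact: (process_sigma_preimage _ _ _ _ _ (fun s => N s) _ [set j]).
have D_nat n w : 0 <= D n%:R w by exact: D_ge0.
have mND n : measurable (NDset n).
  exact: (measurable_random_time _ _ _ _ poissonN (D_nat n)).
have PND n : P (NDset n) = (\int[P]_w (poisson_mass k (lambda * D n%:R w))%:E)%E.
  exact: (poisson_random_time _ _ _ _ lambda_gt0 poissonN (D_nat n) (indepNDn n)).
have fineG n : P (Gset n) = (fine (P (Gset n)))%:E.
  by rewrite fineK// fin_num_measure.
(* The factor [lambda] is put into the variables [X n], so that the Laplace transform of their
   mixture at [u] involves the Bernstein function at [lambda * u]. *)
pose a n := NngNum (fine_ge0 (measure_ge0 P (Gset n))).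
pose X n : {RV P >-> R} := (cst lambda \* D n%:R : {mfun T >-> R}).
have X_ge0 n w : 0 <= X n w by rewrite mulr_ge0// ltW.
pose m := mixture P a X.
have mixE (f : R -> \bar R) : measurable_fun [set: R] f ->
    (forall x : R, 0 <= x -> (0 <= f x)%E) ->
    (\int[m]_(x in `[0%R, +oo[) f x =
     \sum_(0 <= n <oo) P (Gset n) * \int[P]_w f (lambda * D n%:R w)%R)%E.
  move=> mf f0; rewrite integral_mixture//.
  by apply: eq_eseriesr => n _; rewrite /= -fineG.
have mlaplace (u : R) : measurable_fun [set: R] (fun x => (expR (- u * x))%:E).
  by apply/measurable_EFinP; apply: measurableT_comp => //; exact: measurable_funM.
(* The value [u = 0] is included because it gives the total mass of [m], whence [m_fin]. *)
have laplace_m (u : R) : 0 <= u ->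
    (\int[m]_(x in `[0%R, +oo[) (expR (- u * x))%:E =
     (1 / (1 + mu * t * (1 - expR (- bernstein_fun b nu (lambda * u)))))%:E)%E.
  move=> u0; rewrite mixE//.
  rewrite -(geometric_counting_pgf _ _ _ _ _ _ _ _ mu_gt0 geomG t_ge0); last first.
    rewrite expR_ge0 -expR0 ler_expR oppr_le0 bernstein_fun_ge0//.
    by rewrite mulr_ge0// ltW.
  apply: eq_eseriesr => n _; congr (_ * _)%E.
  (* The Laplace exponent at the integer time n gives the n-th power of e^{-f(lambda u)}, as the
     generating function of [G t] requires. *)
  transitivity (expR (- n%:R * bernstein_fun b nu (lambda * u)))%:E; last first.
    by rewrite mulNr -mulrN expRM_natl.
  have lu0 : 0 <= lambda * u by rewrite mulr_ge0// ltW.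
  rewrite -(laplaceD _ _ lu0 (ler0n _ n)) unlock.
  by apply: eq_integral => w _; congr ((expR _)%:E); ring.
have m_fin : (m `[0%R, +oo[%classic < +oo)%E.
  rewrite -[ltLHS]mul1e -integral_cst//.
  rewrite (_ : (\int[m]_(x in _) _ =
      \int[m]_(x in `[0%R, +oo[) (expR (- 0 * x))%:E)%E).
    by rewrite laplace_m// ltry.
  by apply: eq_integral => x _; rewrite oppr0 mul0r expR0.
(* The two signs (-1)^k cancel, which exhibits the Poisson mass as a multiple of the k-th derivative
   of e^{-u x} in u at u = 1. *)
have mass_laplace x : poisson_mass k x =
    (-1) ^+ k / k`!%:R * ((- x) ^+ k * expR (- 1 * x)).
  transitivity (((-1) ^+ k) ^+ 2 * poisson_mass k x).
    by rewrite sqrr_sign mul1r.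
  by rewrite /poisson_mass (exprNn x) mulN1r; ring.
have int1 := laplace_integrable m m_fin k 1 ltr01.
transitivity (\int[m]_(x in `[0%R, +oo[) (poisson_mass k x)%:E)%E.
  rewrite mixE; last 2 first.
  - apply/measurable_EFinP; apply: continuous_measurable_fun.
    exact: continuous_poisson_mass.
  - by move=> x x0; rewrite lee_fin poisson_mass_ge0.
  (* The event is partitioned by the value n of [G t]; on each piece the inner time is the fixed
     number n, and [indepGN] factors the probability. *)
  rewrite (_ : [set w | _] = \bigcup_n (Gset n `&` NDset n)); last first.
    by apply/seteqP; split => [w wk|w [n _ [/= <-]]//]; exists (G t w).
  rewrite measure_semi_bigcup.
  - apply: eq_eseriesr => n _; rewrite -PND; apply: indepGN.
      exact: (process_sigma_preimage _ _ _ _ _ (fun s => G s) _ [set n]).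
    exact: (process_sigma_preimage _ _ _ _ _ (subordinated_poisson N D) _ [set k]).
  - by move=> n; exact: measurableI.
  - apply/trivIsetP => i j _ _ /eqP ij; apply/seteqP; split => // w /=.
    by move=> [[wi _] [wj _]]; apply: ij; rewrite -wi -wj.
  - by apply: bigcup_measurable => n _; exact: measurableI.
under eq_integral do rewrite mass_laplace EFinM.
rewrite integralZl//.
(* The closed form is known to equal the transform only for [u >= 0]; agreement near 1 suffices for
   the derivatives there. *)
rewrite -(eq_near_derive1n _ _ k
  (fun v => \int[m]_(x in `[0, +oo[) expR (- v * x))); last first.
  near=> u; rewrite /Rintegral laplace_m//.
  by apply: ltW; near: u; exact: lt_nbhsr.
rewrite derive1n_laplace// [RHS]EFinM fineK//.
exact: integrable_fin_num int1.
Unshelve. all: end_near. Qed.
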